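(* For all $A, P \in \mathbb{H}^n_{++}$, $$\mathcal{D}_{\mathrm{LD}}(A,P) \ \ge\ \ln K(AP^{-1}).$$ In addition, when $\operatorname{tr}(AP^{-1}) = n$, we have $$\mathcal{D}_{\mathrm{LD}}(A,P) = \ln K(P^{-1}A).$$
   Context: $\mathbb{H}^n_{++}$ denotes the cone of $n\times n$ Hermitian positive definite matrices. For $A,P\in\mathbb{H}^n_{++}$ the Bregman log determinant divergence is $$\mathcal{D}_{\mathrm{LD}}(A,P) = \operatorname{tr}(AP^{-1}) - \ln\det(AP^{-1}) - n.$$ For an $n\times n$ matrix $M$ with positive real eigenvalues (in particular $M = P^{-1}A$, $M = AP^{-1}$ or $M=P^{-1/2}AP^{-1/2}$, which all have the same eigenvalues), Kaporin's condition number is $$K(M) = \left(\frac{\frac1n\operatorname{tr}(M)}{\det(M)^{1/n}}\right)^{n}.$$ *)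

(* Defs.v *)
From mathcomp Require Export all_boot all_order all_algebra.
From mathcomp Require Export sesquilinear spectral.
From mathcomp Require Export complex.
From mathcomp Require Export reals exp.

Set Implicit Arguments.
Unset Strict Implicit.
Unset Printing Implicit Defensive.

Import Order.TTheory GRing.Theory Num.Theory.
Local Open Scope ring_scope.
Local Open Scope complex_scope.
Local Open Scope sesquilinear_scope.

(* In R[i] the order is partial and 0 < z means that z is real and positive. *)
Definition hpd (R : realType) (n : nat) (A : 'M[R[i]]_n) : Prop :=
  A \is hermsymmx /\
  forall x : 'cV[R[i]]_n, x != 0 -> 0 < (x ^t* *m A *m x) 0 0.

(* If A and P are Hermitian positive definite, the eigenvalues of A P^-1 are
   real and positive, so its trace and determinant are positive reals; Re
   only transports them from R[i] to R. *)
Definition logdet_div (R : realType) (n : nat) (A P : 'M[R[i]]_n) : R :=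
  complex.Re (\tr (A *m invmx P)) - ln (complex.Re (\det (A *m invmx P)))
  - n%:R.

(* Meant for matrices with positive real eigenvalues, for which Re is again
   only a change of type. *)
Definition kaporin (R : realType) (n : nat) (M : 'M[R[i]]_n) : R :=
  ((n%:R^-1 * complex.Re (\tr M))
     / (complex.Re (\det M) `^ n%:R^-1)) ^+ n.

(* Main.v *)
Require Import Defs.

(** Put t = tr(A P^-1) and d = det(A P^-1).  Taking logarithms,
    ln K(A P^-1) = n ln (t / n) - ln d, whereas the divergence is t - n - ln d.
    The term ln d cancels, and what remains is n ln m <= n (m - 1) for the
    mean m = t / n of the eigenvalues: the tangent line bound for ln at 1
    ([le_ln1Dx]), which is an equality when m = 1, that is when t = n.
    Passing from A P^-1 to P^-1 A changes neither trace nor determinant.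

    The logarithm of K splits in this way ([ln_kaporin]) because t and d are
    positive.  Positivity of d follows from that of det A and det P
    ([hpd_det_gt0]).  For t ([hpd_tr_mulV_gt0]), diagonalise only P in a
    unitary basis: there t is the sum of the diagonal entries of A, which are
    values of its quadratic form, each divided by an eigenvalue of P.  In this
    way neither a square root of P nor the spectrum of the non-Hermitian matrix
    A P^-1 enters the argument. *)

Import Order.TTheory GRing.Theory Num.Theory.
Local Open Scope ring_scope.
Local Open Scope complex_scope.
Local Open Scope sesquilinear_scope.

(** The entry is the value of the quadratic form of A at the conjugate
    transpose of the i-th row of S, which is nonzero since it has norm 1. *)
Lemma pos_form_conj_diag_gt0 {C : numClosedFieldType} {n} {A S : 'M[C]_n} i :
    (forall x : 'cV[C]_n, x != 0 -> 0 < (x ^t* *m A *m x) 0 0) ->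
  S \is unitarymx -> 0 < (S *m A *m S ^t*) i i.
Proof.
move=> Apos /unitarymxP SS1.
have xt : ((row i S) ^t*) ^t* = row i S by rewrite trmxCK.
have -> : (S *m A *m S ^t*) i i = (((row i S) ^t*) ^t* *m A *m (row i S) ^t*) 0 0.
  by rewrite xt -row_mul !mxE; apply: eq_bigr => k _; rewrite !mxE.
apply: Apos; apply/eqP => x0.
have : (row i S *m (row i S) ^t*) 0 0 = 1.
  have -> : 1 = (1%:M : 'M[C]_n) i i by rewrite mxE eqxx.
  rewrite -SS1 !mxE.
  by apply: eq_bigr => k _; rewrite !mxE.
by rewrite x0 mulmx0 mxE => /esym/eqP; rewrite oner_eq0.
Qed.

(** The eigenvalues are the diagonal entries of A in its unitary eigenbasis,
    so they are covered by [pos_form_conj_diag_gt0]. *)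
Lemma herm_pos_spectral_diag_gt0 {C : numClosedFieldType} {n} {A : 'M[C]_n} i :
    A \is hermsymmx ->
    (forall x : 'cV[C]_n, x != 0 -> 0 < (x ^t* *m A *m x) 0 0) ->
  0 < spectral_diag A 0 i.
Proof.
move=> /hermitian_normalmx/orthomx_spectralP Aeq Apos.
have Su := spectral_unitarymx A.
have := pos_form_conj_diag_gt0 i Apos Su.
rewrite -invmx_unitary // {2}Aeq !mulmxA mulmxV ?spectral_unit // mul1mx.
by rewrite mulmxK ?spectral_unit // mxE eqxx mulr1n.
Qed.

Lemma hpd_det_gt0 {R : realType} {n} {A : 'M[R[i]]_n} : hpd A -> 0 < \det A.
Proof.
case=> Aherm Apos.
have /orthomx_spectralP -> := hermitian_normalmx Aherm.
rewrite !det_mulmx mulrAC -det_mulmx mulVmx ?spectral_unit // det1 mul1r det_diag.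
by apply: prodr_gt0 => i _; apply: herm_pos_spectral_diag_gt0.
Qed.

Lemma hpd_unitmx {R : realType} {n} {A : 'M[R[i]]_n} : hpd A -> A \in unitmx.
Proof. by move=> /hpd_det_gt0 detA; rewrite unitmxE unitfE gt_eqF. Qed.

Lemma hpd_det_mulV_gt0 {R : realType} {n} {A P : 'M[R[i]]_n} :
  hpd A -> hpd P -> 0 < \det (A *m invmx P).
Proof.
by move=> hA hP; rewrite det_mulmx det_inv mulr_gt0 ?invr_gt0 ?hpd_det_gt0.
Qed.

(** With P = S^* D S and S unitary, cyclicity of the trace gives
    tr(A P^-1) = tr(S A S^* D^-1), a sum of products of positive numbers.  The
    sum is nonempty because n > 0. *)
Lemma hpd_tr_mulV_gt0 {R : realType} {n} {A P : 'M[R[i]]_n} : (0 < n)%N ->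
  hpd A -> hpd P -> 0 < \tr (A *m invmx P).
Proof.
case: n A P => // n A P _ [_ Apos] hP; have [Pherm Ppos] := hP.
have Su := spectral_unitarymx P; have Sunit := spectral_unit P.
have Peq : P = invmx (spectralmx P) *m diag_mx (spectral_diag P) *m spectralmx P.
  exact/orthomx_spectralP/hermitian_normalmx.
have dpos i : 0 < spectral_diag P 0 i by apply: herm_pos_spectral_diag_gt0.
set S := spectralmx P in Su Sunit Peq *; set d := spectral_diag P in Peq dpos *.
have Pinv : invmx P = S ^t* *m diag_mx (map_mx GRing.inv d) *m S.
  rewrite -invmx_unitary //; set Q := _ *m _ *m S.
  suff PQ1 : P *m Q = 1%:M by rewrite -[LHS]mulmx1 -PQ1 mulKmx ?hpd_unitmx.
  rewrite {1}Peq /Q !mulmxA mulmxK //.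
  rewrite -(mulmxA (invmx S)) mulmx_diag.
  have -> : (\row_j (d 0 j * map_mx GRing.inv d 0 j)) = const_mx 1.
    by apply/rowP => j; rewrite !mxE divff // gt_eqF.
  by rewrite diag_const_mx mulmx1 mulVmx.
have -> : \tr (A *m invmx P) = \tr (S *m A *m S ^t* *m diag_mx (map_mx GRing.inv d)).
  by rewrite Pinv !mulmxA mxtrace_mulC !mulmxA.
rewrite /mxtrace.
have pos i : 0 < (S *m A *m S ^t* *m diag_mx (map_mx GRing.inv d)) i i.
  rewrite mul_mx_diag mxE [X in _ * X]mxE mulr_gt0 ?invr_gt0 //.
  exact: pos_form_conj_diag_gt0.
by rewrite (bigD1 ord0) //= ltr_wpDr // sumr_ge0 // => i _; rewrite ltW.
Qed.

Lemma ln_kaporin {R : realType} {n} {M : 'M[R[i]]_n} :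
    (0 < n)%N -> 0 < complex.Re (\tr M) -> 0 < complex.Re (\det M) ->
  ln (kaporin M) =
    n%:R * ln (n%:R^-1 * complex.Re (\tr M)) - ln (complex.Re (\det M)).
Proof.
move=> n_gt0 tpos dpos; have n_pos : 0 < n%:R :> R by rewrite ltr0n.
have mpos : 0 < n%:R^-1 * complex.Re (\tr M) by rewrite mulr_gt0 ?invr_gt0.
rewrite /kaporin lnXn ?divr_gt0 ?powR_gt0 // ln_div ?posrE ?powR_gt0 //.
by rewrite ln_powR -[LHS]mulr_natl mulrBr mulrA divff ?mul1r // gt_eqF.
Qed.

Theorem theorem1 (R : realType) (n : nat) (hn : (0 < n)%N)
    (A P : 'M[R[i]]_n) (hA : hpd A) (hP : hpd P) :
  ln (kaporin (A *m invmx P)) <= logdet_div A P /\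
  (\tr (A *m invmx P) = n%:R ->
   logdet_div A P = ln (kaporin (invmx P *m A))).
Proof.
have tpos : 0 < complex.Re (\tr (A *m invmx P)).
  by have := hpd_tr_mulV_gt0 hn hA hP; rewrite ltcE => /andP[].
have dpos : 0 < complex.Re (\det (A *m invmx P)).
  by have := hpd_det_mulV_gt0 hA hP; rewrite ltcE => /andP[].
have n_pos : 0 < n%:R :> R by rewrite ltr0n.
have kapE : kaporin (invmx P *m A) = kaporin (A *m invmx P).
  have detC : \det (invmx P *m A) = \det (A *m invmx P).
    by rewrite !det_mulmx [RHS]mulrC.
  by rewrite /kaporin mxtrace_mulC detC.
rewrite kapE (ln_kaporin hn tpos dpos) /logdet_div.
set t := complex.Re (\tr _) in tpos *; set d := complex.Re (\det _).
split=> [|trE].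
  rewrite addrAC lerD2r; set m := n%:R^-1 * t.
  have m_pos : 0 < m by rewrite mulr_gt0 ?invr_gt0.
  have -> : t - n%:R = n%:R * (m - 1) by rewrite mulrBr mulr1 mulVKf ?gt_eqF.
  have := @le_ln1Dx _ (m - 1); rewrite ltrBrDl addrCA !subrr addr0 => /(_ m_pos).
  by rewrite ler_pM2l.
have -> : t = n%:R by rewrite /t trE -(rmorph_nat (real_complex R)).
by rewrite (mulVf (lt0r_neq0 n_pos)) ln1 mulr0 addrAC subrr.
Qed.
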